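(* Let $\mathcal{N}=\{X_n(k)\mid k\in[0,k_{max}]\}$ be a closed natural motion trajectory, let $\rho_k\ge 0$ be scale factors and let $\mathcal{T}_{\mathcal{N}}=\bigcup_{k\in[0,k_{max}]}\mathcal{E}_{k,\mathcal{N}}$ with $\mathcal{E}_{k,\mathcal{N}}=\{X\in\mathbb{R}^6\mid (X-X_n(k))^TP(X-X_n(k))\le\rho_k\}$. Suppose that (A1) the closed-loop dynamics are $X(k+1)=\bar{A}X(k)-BKX_n(k+\delta)$ and the error dynamics are $e(k+1)=\bar{A}e(k)$, where $e(k)=X(k)-X_n(k+\delta)$ and $\bar A=A+BK$ (with $\bar A$ invertible); and (A2) $P=P^T>0$ is chosen such that $\bar{A}^TP\bar{A}-P=-Q$ with $Q=Q^T>0$. Then the tube $\mathcal{T}_{\mathcal{N}}$ is positively-invariant if and only if $$\rho_k\le\rho_{k+1}+d(\rho_{k+1})\quad\text{for all }k\in\mathbb{Z}_{\ge0},$$ where $$d(\rho_{k+1})=\min_{e(k+1)}\ e(k)^TPe(k)-e(k+1)^TPe(k+1)\quad\text{subject to } e(k+1)^TPe(k+1)=\rho_{k+1},$$ with $e(k)=\bar A^{-1}e(k+1)$ and $e(k+1)$ ranging over $\mathbb{R}^6$.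
   Context: Dynamics: $X=[x\ y\ z\ \dot x\ \dot y\ \dot z]^T\in\mathbb{R}^6$, $X(k+1)=AX(k)+Bu(k)$, $k\in\mathbb{Z}_{\ge0}$, $u(k)\in\mathbb{R}^3$, with $\Delta T>0$, $m>0$, $\omega>0$ and $A=\exp(A_c\Delta T)$, $B=\int_0^{\Delta T}\exp(A_c(\Delta T-s))\,ds\begin{bmatrix}0_{3\times3}\\ \frac1m I_{3\times3}\end{bmatrix}$, $$A_c=\begin{bmatrix}0&0&0&1&0&0\\0&0&0&0&1&0\\0&0&0&0&0&1\\3\omega^2&0&0&0&2\omega&0\\0&0&0&-2\omega&0&0\\0&0&-\omega^2&0&0&0\end{bmatrix}$$ (Clohessy-Wiltshire equations). $\Delta T$ is chosen so that $\tau/\Delta T\in\mathbb{Z}_{>0}$, where $\tau=2\pi/\omega$, and $k_{max}=\tau/\Delta T-1$. Closed natural motion trajectory (NMT): for an initial condition $\bar X_0$ whose components satisfy $\dot y(0)=-2\omega x(0)$, $\mathcal{N}=\{X_n(k)\mid X_n(0)=\bar X_0,\ X_n(k+1)=AX_n(k),\ k\in[0,k_{max}]\}$. The sequence is periodic, $X_n(k_{max}+1)=X_n(0)$. Here $[0,k_{max}]$ denotes integers, and any index $k$ (of $X_n(k)$, $\rho_k$, $\mathcal{E}_{k,\mathcal{N}}$) outside $[0,k_{max}]$ is taken to be the equivalent index in $[0,k_{max}]$ modulo $k_{max}+1$. Control: $u(k)=K(X(k)-X_n(k+\delta))$, where $\delta\in\mathbb{Z}$ is a shift and $K$ is a gain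 matrix for which $\bar A=A+BK$ is Schur (all eigenvalues in the open unit disk). Positive invariance: $\mathcal{T}_{\mathcal{N}}$ is positively-invariant with respect to the closed-loop dynamics if there exists $\delta\in\mathbb{Z}$ such that, for every $k_1\in\mathbb{Z}_{\ge0}$ and every sequence $(X(k))_{k\ge k_1}$ satisfying $X(k+1)=\bar AX(k)-BKX_n(k+\delta)$ for $k\ge k_1$, $X(k_1)\in\mathcal{E}_{k_1+\delta,\mathcal{N}}$ implies $X(k_2)\in\mathcal{E}_{k_2+\delta,\mathcal{N}}$ for all integers $k_2\ge k_1$. *)

(* Defs.v *)
From mathcomp Require Import all_boot all_order all_algebra.
From mathcomp Require Import all_classical all_reals all_analysis.
From mathcomp Require Import complex.
Set Implicit Arguments.
Unset Strict Implicit.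
Unset Printing Implicit Defensive.
Import Order.TTheory GRing.Theory Num.Theory.
Import numFieldNormedType.Exports.
Local Open Scope classical_set_scope.
Local Open Scope ring_scope.

Definition mxexp (R : realType) (n : nat) (M : 'M[R]_n.+1) : 'M[R]_n.+1 :=
  limn (series (fun k => k`!%:R^-1 *: M ^+ k)).

Definition mxintegral (R : realType) (m n : nat) (a b : R)
    (F : R -> 'M[R]_(m, n)) : 'M[R]_(m, n) :=
  \matrix_(i, j) Rintegral lebesgue_measure `[a, b] (fun s => F s i j).

(* State coordinates 0, ..., 5 are x, y, z and their derivatives. *)
Definition cwAc (R : realType) (omega : R) : 'M[R]_6 :=
  \matrix_(i, j) nth 0 (nth [::]
    [:: [:: 0; 0; 0; 1; 0; 0];
        [:: 0; 0; 0; 0; 1; 0];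
        [:: 0; 0; 0; 0; 0; 1];
        [:: 3 * omega ^+ 2; 0; 0; 0; 2 * omega; 0];
        [:: 0; 0; 0; - (2 * omega); 0; 0];
        [:: 0; 0; - omega ^+ 2; 0; 0; 0]] i) j.

Definition cwA (R : realType) (omega dT : R) : 'M[R]_6 :=
  mxexp (dT *: cwAc omega).

Definition cwB (R : realType) (omega dT m : R) : 'M[R]_(6, 3) :=
  mxintegral 0 dT (fun s => mxexp ((dT - s) *: cwAc omega))
  *m (col_mx (0 : 'M[R]_3) (m^-1)%:M : 'M[R]_(3 + 3, 3)).

Definition schur (R : realType) (n : nat) (M : 'M[R]_n) : Prop :=
  forall lam : R[i], eigenvalue (map_mx (real_complex R) M) lam -> `|lam| < 1.

Definition quadform (R : realType) (n : nat) (P : 'M[R]_n) (v : 'cV[R]_n) : R :=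
  (v^T *m P *m v) 0 0.

Definition sym_posdef (R : realType) (n : nat) (P : 'M[R]_n) : Prop :=
  P^T = P /\ forall v : 'cV[R]_n, v != 0 -> 0 < quadform P v.

(* Residue of k modulo kmax + 1: all time indices are read through it. *)
Definition cyc (kmax : nat) (k : int) : 'I_kmax.+1 :=
  inord `|(k %% kmax.+1%:Z)%Z|%N.

(* X_n(k): the natural motion X_n(k+1) = A X_n(k) from X0 on [0, kmax],
   extended to all integers by reducing the index modulo kmax + 1. *)
Definition nmt (R : realType) (kmax : nat) (A : 'M[R]_6) (X0 : 'cV[R]_6)
    (k : int) : 'cV[R]_6 :=
  iter (cyc kmax k) (mulmx A) X0.

Definition closed_nmt_init (R : realType) (omega : R) (X0 : 'cV[R]_6) : Prop :=
  X0 (inord 4) 0 = - (2 * omega) * X0 (inord 0) 0.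

(* The section of the tube around X_n(k); the tube is the union of the
   sections, which is never needed without its decomposition. *)
Definition ellipsoid (R : realType) (kmax : nat) (P : 'M[R]_6)
    (Xn : int -> 'cV[R]_6) (rho : 'I_kmax.+1 -> R) (k : int) : set 'cV[R]_6 :=
  [set X | quadform P (X - Xn k) <= rho (cyc kmax k)].

(* Only the values X k with k >= k1 matter. *)
Definition closed_loop (R : realType) (A : 'M[R]_6) (B : 'M[R]_(6, 3))
    (K : 'M[R]_(3, 6)) (Xn : int -> 'cV[R]_6) (delta : int) (k1 : nat)
    (X : nat -> 'cV[R]_6) : Prop :=
  forall k : nat, (k1 <= k)%N ->
    X k.+1 = (A + B *m K) *m X k - B *m K *m Xn (k%:Z + delta).

Definition tracking_error (R : realType) (Xn : int -> 'cV[R]_6) (delta : int)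
    (X : nat -> 'cV[R]_6) (k : nat) : 'cV[R]_6 :=
  X k - Xn (k%:Z + delta).

Definition error_dynamics (R : realType) (A : 'M[R]_6) (B : 'M[R]_(6, 3))
    (K : 'M[R]_(3, 6)) (Xn : int -> 'cV[R]_6) : Prop :=
  forall (delta : int) (k1 : nat) (X : nat -> 'cV[R]_6),
    closed_loop A B K Xn delta k1 X ->
    forall k : nat, (k1 <= k)%N ->
      tracking_error Xn delta X k.+1
      = (A + B *m K) *m tracking_error Xn delta X k.

Definition positively_invariant (R : realType) (A : 'M[R]_6)
    (B : 'M[R]_(6, 3)) (K : 'M[R]_(3, 6)) (Xn : int -> 'cV[R]_6)
    (E : int -> set 'cV[R]_6) : Prop :=
  exists delta : int, forall (k1 : nat) (X : nat -> 'cV[R]_6),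
    closed_loop A B K Xn delta k1 X ->
    E (k1%:Z + delta) (X k1) ->
    forall k2 : nat, (k1 <= k2)%N -> E (k2%:Z + delta) (X k2).

(* The least element of S, which is thus attained; junk if there is none. *)
Definition set_min (R : realType) (S : set R) : R := get (S `&` lbound S).

(* e is e(k+1), and Abar^-1 e is e(k). *)
Definition min_decrease (R : realType) (Abar P : 'M[R]_6) (r : R) : R :=
  set_min [set quadform P (invmx Abar *m e) - quadform P e
          | e in [set e : 'cV[R]_6 | quadform P e = r]].

(* Main.v *)
Require Import Defs.
From mathcomp Require Import all_boot all_order all_algebra.
From mathcomp Require Import all_classical all_reals all_analysis.
From mathcomp Require Import lra.
Import Order.TTheory GRing.Theory Num.Theory.
Import numFieldNormedType.Exports.
Local Open Scope ring_scope.

Set Implicit Arguments.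
Unset Strict Implicit.
Unset Printing Implicit Defensive.

(** Write V(e) = e^T P e and M = Abar.  The tracking error evolves by
e(k+1) = M e(k) whatever the shift delta, and the section of the tube around
X_n(k + delta) contains X(k) exactly when V(e(k)) <= rho_(k + delta).
Invariance is therefore the one-step property

  V(e) <= rho_k  implies  V(M e) <= rho_(k+1),  for all e and all k

([invariant_stepP]).  The shift disappears because every error is realized by
some closed-loop trajectory starting at a time of our choice, and because the
indices are read modulo kmax + 1, so that every residue k is reached as
k1 + delta for some time k1 >= 0.

As the decrease is V(M^-1 f) - V(f) on the level V(f) = rho_(k+1), the
condition rho_k <= rho_(k+1) + d(rho_(k+1)) says that rho_k is at most the
minimum of V(M^-1 f) over this level ([le_add_min_decrease]).  The minimum
exists: by positive definiteness the level sets of V are compact, since V is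
bounded below by a positive multiple of the squared norm.

The two properties are equivalent since V is homogeneous of degree 2 and M is
linear ([sublevel_stepP]).  An error e with V(e) <= rho_k and
V(M e) > rho_(k+1) can be shrunk until V(M e) = rho_(k+1), which makes V(e)
smaller than rho_k; conversely f with V(f) = rho_(k+1) and V(M^-1 f) < rho_k
can be enlarged until V(M^-1 f) = rho_k, which pushes V(f) beyond rho_(k+1).
When rho_(k+1) = 0 the only such f is 0, and any error on the level rho_k > 0
takes its place. *)

Lemma quadformZ (R : realType) n (P : 'M[R]_n) a (v : 'cV[R]_n) :
  quadform P (a *: v) = a ^+ 2 * quadform P v.
Proof.
by rewrite /quadform -scalemxAr linearZ /= -!scalemxAl scalerA mxE expr2.
Qed.

Lemma quadform0 (R : realType) n (P : 'M[R]_n) : quadform P 0 = 0.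
Proof. by rewrite /quadform mulmx0 mxE. Qed.

Lemma quadform_mulmx (R : realType) n (P M : 'M[R]_n) (v : 'cV[R]_n) :
  quadform P (M *m v) = quadform (M^T *m P *m M) v.
Proof. by rewrite /quadform trmx_mul !mulmxA. Qed.

Lemma quadform_sum (R : realType) n (P : 'M[R]_n) (v : 'cV[R]_n) :
  quadform P v = \sum_j \sum_i v i 0 * P i j * v j 0.
Proof.
rewrite /quadform mxE; apply: eq_bigr => j _.
by rewrite mxE mulr_suml; apply: eq_bigr => i _; rewrite mxE.
Qed.

Lemma quadform_gt0 (R : realType) n (P : 'M[R]_n) (v : 'cV[R]_n) :
  sym_posdef P -> v != 0 -> 0 < quadform P v.
Proof. by case=> _; exact. Qed.

Lemma continuous_quadform_tr (R : realType) n (P : 'M[R]_n) :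
  continuous (fun u : 'rV[R]_n => quadform P u^T).
Proof.
have -> : (fun u : 'rV[R]_n => quadform P u^T) =
          (fun u => \sum_j \sum_i u 0 i * P i j * u 0 j).
  apply/funext => u; rewrite quadform_sum.
  by apply: eq_bigr => j _; apply: eq_bigr => i _; rewrite !mxE.
apply: continuous_big => [|j _]; first exact: add_continuous.
apply: continuous_big => [|i _]; first exact: add_continuous.
move=> u; apply: (@continuousM R 'rV[R]_n); last exact: coord_continuous.
apply: (@continuousM R 'rV[R]_n); first exact: coord_continuous.
exact: cst_continuous.
Qed.

(** By homogeneity, the squared ratio t^2 by which v has to be scaled to reach
level r is r / V(v); comparing it with 1 tells whether v is shrunk or
enlarged. *)
Lemma quadform_rescale (R : realType) n (P : 'M[R]_n) (v : 'cV[R]_n) (r : R) :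
  sym_posdef P -> v != 0 -> 0 <= r ->
  exists t, t ^+ 2 = r / quadform P v /\ quadform P (t *: v) = r.
Proof.
move=> posP v0 r0; have Vv := quadform_gt0 posP v0.
exists (Num.sqrt (r / quadform P v)).
have t2 : Num.sqrt (r / quadform P v) ^+ 2 = r / quadform P v.
  by rewrite sqr_sqrtr // divr_ge0 // ltW.
by split; rewrite // quadformZ t2 divfK // gt_eqF.
Qed.

Lemma quadform_level_nonempty (R : realType) n (P : 'M[R]_n.+1) (r : R) :
  sym_posdef P -> 0 <= r -> exists v, quadform P v = r.
Proof.
move=> posP r0.
have one_neq0 : (const_mx 1 : 'cV[R]_n.+1) != 0.
  by apply/eqP => /matrixP/(_ 0 0)/eqP; rewrite !mxE oner_eq0.
have [t [_ tr]] := quadform_rescale posP one_neq0 r0.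
by exists (t *: const_mx 1).
Qed.

(** The constant is the minimum of the form on the unit sphere, which is compact
and avoids 0; homogeneity carries the bound to all vectors. *)
Lemma quadform_coercive (R : realType) n (P : 'M[R]_n) : sym_posdef P ->
  exists2 c : R, 0 < c & forall u : 'rV[R]_n, c * `|u| ^+ 2 <= quadform P u^T.
Proof.
move=> posP.
pose S := [set u : 'rV[R]_n | `|u| = 1]%classic.
have normalize (u : 'rV[R]_n) : u != 0 -> S (`|u|^-1 *: u).
  by move=> u0; apply: normrZV; rewrite unitfE normr_eq0.
have [[w Sw]|S0] := pselect (exists w, S w); last first.
  (* Without unit vectors the space is 0, and any constant will do. *)
  exists 1 => // u; have [->|u0] := eqVneq u 0.
    by rewrite normr0 expr0n mulr0 trmx0 quadform0.
  by case: S0; exists (`|u|^-1 *: u); exact: normalize.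
have cS : compact S.
  apply: bounded_closed_compact.
    exists 1; split => // x x1 u /= ->; exact: ltW.
  have -> : S = ((fun u : 'rV[R]_n => `|u|) @^-1` [set 1])%classic by [].
  apply: preimage_closed => [u _|]; first exact: norm_continuous.
  exact: closed_eq.
have cV : {within S, continuous (fun u : 'rV[R]_n => quadform P u^T)}%classic.
  exact/continuous_subspaceT/continuous_quadform_tr.
have [|z zS zmin] := EVT_min_rV _ cS cV; first by exists w.
exists (quadform P z^T) => [|u].
  apply: (quadform_gt0 posP); apply/eqP => zT0.
  move: zS; rewrite -[z]trmxK zT0 trmx0 inE /S /= normr0 => /eqP.
  by rewrite eq_sym oner_eq0.
have [->|u0] := eqVneq u 0.
  by rewrite normr0 expr0n mulr0 trmx0 quadform0.
have nu : 0 < `|u| by rewrite normr_gt0.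
have := zmin (`|u|^-1 *: u); rewrite inE => /(_ (normalize u u0)).
rewrite [X in _ <= X -> _]/= [(_ *: u)^T]linearZ /= quadformZ exprVn mulrC.
by rewrite ler_pdivlMr // exprn_gt0.
Qed.

Lemma quadform_level_compact (R : realType) n (P : 'M[R]_n) (r : R) :
  sym_posdef P -> compact [set u : 'rV[R]_n | quadform P u^T = r]%classic.
Proof.
move=> posP; have [c c0 cP] := quadform_coercive posP.
apply: bounded_closed_compact; last first.
  apply: (@preimage_closed _ _ (fun u : 'rV[R]_n => quadform P u^T)
    [set r]%classic).
    by move=> u _; exact: continuous_quadform_tr.
  exact: closed_eq.
(* On the level, |u|^2 <= |r| / c, and |u| <= 1 + |u|^2. *)
exists (1 + `|r| / c); split=> [|x xr u /= Pu]; first exact: num_real.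
apply: ltW; apply: le_lt_trans xr.
have := cP u; rewrite Pu => /le_trans/(_ (ler_norm r)).
rewrite mulrC -ler_pdivlMr // => un.
apply: le_trans (_ : 1 + `|u| ^+ 2 <= _); last by rewrite lerD2l.
by have := sqr_ge0 (`|u| - 1 / 2); have := normr_ge0 u; nra.
Qed.

Lemma quadform_level_min (R : realType) n (P M : 'M[R]_n.+1) (r : R) :
  sym_posdef P -> 0 <= r ->
  exists2 f, quadform P f = r &
    forall g, quadform P g = r -> quadform M f <= quadform M g.
Proof.
move=> posP r0.
have [v vr] := quadform_level_nonempty posP r0.
have cM : {within [set u : 'rV[R]_n.+1 | quadform P u^T = r],
    continuous (fun u : 'rV[R]_n.+1 => quadform M u^T)}%classic.
  exact/continuous_subspaceT/continuous_quadform_tr.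
have [||z] := EVT_min_rV _ _ cM.
- by exists v^T; rewrite /= trmxK.
- exact: quadform_level_compact.
rewrite inE /= => zr zmin; exists z^T => // g gr.
by rewrite -[g]trmxK; apply: zmin; rewrite inE /= trmxK.
Qed.

(** [min_decrease] is chosen as a least element, so it carries information only
once the minimum is known to be attained.  It is, as V(M^-1 f) is a quadratic
form in f and V(f) is constant on the level. *)
Lemma le_add_min_decrease (R : realType) (M P : 'M[R]_6) (a r : R) :
  sym_posdef P -> 0 <= r ->
  a <= r + min_decrease M P r <->
  forall f, quadform P f = r -> a <= quadform P (invmx M *m f).
Proof.
move=> posP r0.
have [f fr fmin] :=
  quadform_level_min ((invmx M)^T *m P *m invmx M) posP r0.
have [[g gr gE] dlb] : let S := [set quadform P (invmx M *m e) - quadform P e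
    | e in [set e : 'cV[R]_6 | quadform P e = r]]%classic in
    (S `&` lbound S)%classic (min_decrease M P r).
  apply: (@getPex R); exists (quadform P (invmx M *m f) - quadform P f).
  split; first by exists f.
  by move=> _ [g /= gr <-]; rewrite fr gr lerD2r !quadform_mulmx fmin.
rewrite /= in gr gE; split => [ad e er|amin].
  have : min_decrease M P r <= quadform P (invmx M *m e) - quadform P e.
    by apply: dlb; exists e.
  by rewrite er; lra.
by have := amin g gr; rewrite -gE gr; lra.
Qed.

(** A vector violating one side is rescaled, by homogeneity of the form and
linearity of M, to one violating the other. *)
Lemma sublevel_stepP (R : realType) n (M P : 'M[R]_n.+1) (a b : R) :
  M \in unitmx -> sym_posdef P -> 0 <= a -> 0 <= b ->
  (forall e, quadform P e <= a -> quadform P (M *m e) <= b) <->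
  (forall f, quadform P f = b -> a <= quadform P (invmx M *m f)).
Proof.
move=> uM posP a0 b0; split=> [step f fb|back e ea].
- rewrite leNgt; apply/negP => fa.
  have [f0|f0] := eqVneq f 0.
    (* The level b = 0 is the origin, which cannot be enlarged: any e on the
       level a > 0 then breaks the step, as M e is not 0. *)
    move: fa; rewrite f0 mulmx0 quadform0 => a_gt0.
    have [e ea] := quadform_level_nonempty posP a0.
    have e0 : M *m e != 0.
      apply/eqP => Me; move: ea; rewrite -[e](mulKmx uM) Me mulmx0 quadform0.
      by move=> a_eq0; rewrite a_eq0 ltxx in a_gt0.
    have := step e; rewrite ea lexx => /(_ isT).
    by rewrite -fb f0 quadform0 leNgt quadform_gt0.
  have Vf := quadform_gt0 posP f0.
  have g0 : invmx M *m f != 0.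
    by apply: contra f0 => /eqP g0; rewrite -[f](mulKVmx uM) g0 mulmx0.
  (* Here t^2 = a / V(M^-1 f) > 1. *)
  have [t [t2 ta]] := quadform_rescale posP g0 a0.
  have := step (t *: (invmx M *m f)); rewrite ta lexx => /(_ isT).
  rewrite -scalemxAr mulKVmx // quadformZ t2 -fb leNgt ltr_pMl //.
  by rewrite ltr_pdivlMr ?quadform_gt0 // mul1r fa.
- rewrite leNgt; apply/negP => be.
  have Me0 : M *m e != 0.
    by apply/eqP => Me; move: be; rewrite Me quadform0 ltNge b0.
  have e0 : e != 0 by apply: contra Me0 => /eqP ->; rewrite mulmx0.
  (* Here t^2 = b / V(M e) < 1. *)
  have [t [t2 tb]] := quadform_rescale posP Me0 b0.
  have := back _ tb; rewrite -scalemxAr mulKmx // quadformZ t2.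
  apply/negP; rewrite -ltNge; apply: lt_le_trans ea.
  rewrite gtr_pMl ?quadform_gt0 // ltr_pdivrMr ?mul1r //.
  exact: quadform_gt0.
Qed.

Lemma cyc_congr kmax (k l : int) :
  (k = l %[mod kmax.+1%:Z])%Z -> cyc kmax k = cyc kmax l.
Proof. by rewrite /cyc => ->. Qed.

Lemma closed_loop_from (R : realType) (A : 'M[R]_6) (B : 'M[R]_(6, 3))
    (K : 'M[R]_(3, 6)) Xn delta k1 (x : 'cV[R]_6) :
  exists2 X, closed_loop A B K Xn delta k1 X & X k1 = x.
Proof.
pose F k y := (A + B *m K) *m y - B *m K *m Xn (k%:Z + delta).
exists (fun k => iteri (k - k1) (fun i => F (k1 + i)%N) x) => [k lek|].
  by rewrite subSn //= /F subnKC.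
by rewrite subnn.
Qed.

(** The centre of the section cancels in the tracking error, so only the radii
remember the time index; that is why neither the shift nor the nominal motion
survives on the right-hand side. *)
Lemma invariant_stepP (R : realType) (kmax : nat) (A : 'M[R]_6)
    (B : 'M[R]_(6, 3)) (K : 'M[R]_(3, 6)) (P : 'M[R]_6) Xn
    (rho : 'I_kmax.+1 -> R) :
  error_dynamics A B K Xn ->
  positively_invariant A B K Xn (ellipsoid P Xn rho) <->
  forall (k : nat) e, quadform P e <= rho (cyc kmax k%:Z) ->
    quadform P ((A + B *m K) *m e) <= rho (cyc kmax k.+1%:Z).
Proof.
move=> errdyn; split=> [[delta inv] k e ek|step].
  (* A starting time k1 >= 0 with k1 + delta congruent to k. *)
  pose k1 := `|((k%:Z - delta) %% kmax.+1%:Z)%Z|%N.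
  have k1E : k1%:Z = ((k%:Z - delta) %% kmax.+1%:Z)%Z.
    by rewrite /k1 gez0_abs // modz_ge0.
  have cycE (i : int) :
      cyc kmax (i + k1%:Z + delta) = cyc kmax (i + k%:Z).
    apply: cyc_congr; rewrite k1E addrAC modzDmr; congr (_ %% _)%Z.
    by rewrite addrACA subrr addr0.
  have [X clX X1] := closed_loop_from A B K Xn delta k1
    (e + Xn (k1%:Z + delta)).
  have err1 : tracking_error Xn delta X k1 = e.
    by rewrite /tracking_error X1 addrK.
  have := inv k1 X clX; rewrite /ellipsoid /= -/(tracking_error _ _ _ _) err1.
  have := cycE 0; rewrite !add0r => -> /(_ ek k1.+1 (leqnSn _)).
  rewrite -/(tracking_error Xn delta X k1.+1) (errdyn _ _ _ clX) // err1.
  by have := cycE 1; rewrite -!intS => ->.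
(* A step valid at every index gives invariance for any shift, such as 0. *)
exists 0 => k1 X clX X1 k2 /subnKC <-.
elim: (k2 - k1)%N => [|j]; first by rewrite addn0.
rewrite addnS /ellipsoid /= -!/(tracking_error Xn 0 X _) !addr0.
by rewrite (errdyn _ _ _ clX) ?leq_addr //; exact: step.
Qed.

Unset Implicit Arguments.

Theorem theorem2 (R : realType) (omega dT m : R) (kmax : nat)
  (omega_gt0 : 0 < omega) (dT_gt0 : 0 < dT) (m_gt0 : 0 < m)
  (period : 2 * pi / omega / dT = kmax.+1%:R)
  (X0 : 'cV[R]_6) (X0_closed : closed_nmt_init omega X0)
  (K : 'M[R]_(3, 6)) (P Q : 'M[R]_6) (rho : 'I_kmax.+1 -> R)
  (rho_ge0 : forall k, 0 <= rho k) :
  let A := cwA omega dT in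
  let B := cwB omega dT m in
  let Abar := A + B *m K in
  let Xn := nmt kmax A X0 in
  schur Abar ->
  error_dynamics A B K Xn ->
  Abar \in unitmx ->
  sym_posdef P ->
  sym_posdef Q ->
  Abar^T *m P *m Abar - P = - Q ->
  (positively_invariant A B K Xn (ellipsoid P Xn rho) <->
   forall k : nat,
     rho (cyc kmax k%:Z) <=
     rho (cyc kmax k.+1%:Z) + min_decrease Abar P (rho (cyc kmax k.+1%:Z))).
Proof.
move=> A B Abar Xn _ errdyn uAbar posP _ _.
rewrite (invariant_stepP P rho errdyn) -/Abar.
have decP k := le_add_min_decrease Abar (rho (cyc kmax k%:Z)) posP
  (rho_ge0 (cyc kmax k.+1%:Z)).
have stepP k := sublevel_stepP uAbar posP (rho_ge0 (cyc kmax k%:Z))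
  (rho_ge0 (cyc kmax k.+1%:Z)).
by split=> H k; [apply/decP/stepP|apply/stepP/decP]; exact: H.
Qed.
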